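(* Let $\mathbf{p}$ be the Pell sequence, fixed point of the substitution $0\mapsto001$, $1\mapsto0$. For an integer $k\ge1$, $\mathbf{p}$ is totally $(k,1)$-unbalanced if and only if $k\ge6$. Moreover, $\mathbf{p}$ is not totally $(k,2)$-unbalanced for any $k$.
   Context: For positive integers $k,C$, a sequence $\mathbf{x}$ is totally $(k,C)$-unbalanced if for every length-$k$ factor $w$ of $\mathbf{x}$ there exist two factors $u,v$ of $\mathbf{x}$ with $|u|=|v|$ and $||u|_w-|v|_w|>C$, where $|u|_w$ is the number of (possibly overlapping) occurrences of $w$ in $u$. *)

(* Defs.v *)
From mathcomp Require Import all_boot.
Set Implicit Arguments. Unset Strict Implicit. Unset Printing Implicit Defensive.

Definition pell_sub (a : nat) : seq nat := if a == 0 then [:: 0; 0; 1] else [:: 0].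
Definition pell_subw (w : seq nat) : seq nat := flatten (map pell_sub w).

(* The fixed point starting with 0: p_i is the i-th letter of sigma^(i+1)(0)
   (which has length > i, and sigma^n(0) is a prefix of sigma^(n+1)(0)). *)
Definition pell (i : nat) : nat := nth 0 (iter i.+1 pell_subw [:: 0]) i.

Definition factor_at (x : nat -> nat) (i n : nat) : seq nat := mkseq (fun j => x (i + j)) n.

Definition is_factor (x : nat -> nat) (w : seq nat) : Prop :=
  exists i, w = factor_at x i (size w).

Definition occ (w u : seq nat) : nat :=
  count (fun i => take (size w) (drop i u) == w) (iota 0 (size u - size w).+1).

Definition totally_unbalanced (x : nat -> nat) (k C : nat) : Prop :=
  forall w, size w = k -> is_factor x w ->
    exists u v, [/\ is_factor x u, is_factor x v, size u = size v &
                    (C < occ w u - occ w v \/ C < occ w v - occ w u)].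

(* Main.v *)
Require Import Defs.
From mathcomp Require Import all_boot.
From mathcomp Require Import zify.

Set Implicit Arguments. Unset Strict Implicit. Unset Printing Implicit Defensive.

(* Write sigma for the substitution. The sequence is cut into blocks sigma(0) = 001
   and sigma(1) = 0 whose starting positions are exactly the occurrences of 00.
   Hence an occurrence of sigma(v)00 is the image of an occurrence of v, and every
   factor containing a 1 extends uniquely to a factor sigma(v)00 (so do 000, but
   not 0 and 00).

   A factor w has two windows of equal length whose counts differ by at least 2
   as soon as two gaps between consecutive occurrences of w differ by at least 2.
   By desubstitution down to 0 or 00, the difference of the Parikh vectors of two
   returns to w is M^n(0,1) or M^n(1,1), M being the matrix of sigma; its length
   is at least 2 except for the factor 0 and the factors extending to 00100.

   For the upper bound, every length k is that of some w whose occurrences are, up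
   to a shift, the starting positions of the blocks sigma^n(0) for some n. Since
   |sigma^n(1)| <= |sigma^n(0)|, the balance of the sequence bounds the difference
   of counts in two windows of equal length by 2. *)

(** * Blocks and balance *)

Definition pell_word n := iter n pell_subw [:: 0].

Lemma pell_subw_cat u v : pell_subw (u ++ v) = pell_subw u ++ pell_subw v.
Proof. by rewrite /pell_subw map_cat flatten_cat. Qed.

Lemma pell_wordS_cat n : exists v, pell_word n.+1 = pell_word n ++ v.
Proof.
elim: n => [|n [v IH]]; first by exists [:: 0; 1].
exists (pell_subw v); rewrite -pell_subw_cat.
by rewrite [pell_word n.+2]/(pell_subw (pell_word n.+1)) IH.
Qed.

Lemma pell_word_cat n d : exists v, pell_word (d + n) = pell_word n ++ v.
Proof.
elim: d => [|d [v IH]]; first by exists [::]; rewrite cats0.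
have [v' E] := pell_wordS_cat (d + n).
by exists (v ++ v'); rewrite addSn E IH catA.
Qed.

Lemma leq_size_pell_subw w : size w <= size (pell_subw w).
Proof.
elim: w => //= a w IH; rewrite /pell_subw /= size_cat -/(pell_subw w).
by rewrite /pell_sub; case: (a == 0) => /=; lia.
Qed.

Lemma ltn_size_pell_word n : n < size (pell_word n).
Proof.
elim: n => // n IH; have [v] := pell_word_cat 0 n; rewrite addn0 => E.
rewrite [pell_word n.+1]/(pell_subw (pell_word n)); move: IH; rewrite E.
by rewrite /=; have := leq_size_pell_subw v; rewrite /pell_subw /=; lia.
Qed.

Lemma nth_pell_word n i : i < size (pell_word n) -> nth 0 (pell_word n) i = pell i.
Proof.
move=> lt_i; rewrite /pell -/(pell_word i.+1).
have lt_i1 := ltn_trans (ltnSn i) (ltn_size_pell_word i.+1).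
have [v E] := pell_word_cat n i.+1; have [v' E'] := pell_word_cat i.+1 n.
have -> : nth 0 (pell_word n) i = nth 0 (pell_word (i.+1 + n)) i.
  by rewrite E nth_cat lt_i.
by rewrite addnC E' nth_cat lt_i1.
Qed.

(* The image under the substitution of the [i]-th letter starts at position [bd i]. *)
Definition bd i := size (pell_subw (mkseq pell i)).

Lemma bdS i : bd i.+1 = bd i + size (pell_sub (pell i)).
Proof.
by rewrite /bd mkseqS -cats1 pell_subw_cat size_cat /pell_subw /= cats0.
Qed.

Lemma pell_bd i r : r < size (pell_sub (pell i)) ->
  pell (bd i + r) = nth 0 (pell_sub (pell i)) r.
Proof.
move=> lt_r; have lt_i := ltn_size_pell_word i.
have Ei : mkseq pell i = take i (pell_word i).
  apply: (@eq_from_nth _ 0) => [|j]; rewrite size_mkseq ?size_takel ?(ltnW lt_i) // => lt_j.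
  by rewrite nth_mkseq // nth_take // nth_pell_word // (ltn_trans lt_j lt_i).
have Ew : pell_word i.+1 = pell_subw (mkseq pell i) ++ (pell_sub (pell i) ++
    pell_subw (drop i.+1 (pell_word i))).
  have -> : pell_word i.+1 = pell_subw (pell_word i) by [].
  by rewrite Ei -[in LHS](cat_take_drop i (pell_word i)) pell_subw_cat (drop_nth 0 lt_i) nth_pell_word.
rewrite -(@nth_pell_word i.+1); last by rewrite Ew !size_cat ltn_add2l ltn_addr.
by rewrite Ew nth_cat ltnNge leq_addr addKn nth_cat lt_r.
Qed.

Lemma bd_cover m : exists i r, m = bd i + r /\ r < size (pell_sub (pell i)).
Proof.
elim: m => [|m [i [r [-> lt_r]]]].
  by exists 0, 0; split=> //; rewrite /pell_sub; case: (_ == 0).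
have [lt_r1|] := ltnP r.+1 (size (pell_sub (pell i))).
  by exists i, r.+1; split; rewrite ?addnS.
move=> le_r; exists i.+1, 0; split; last by rewrite /pell_sub; case: (_ == 0).
by rewrite bdS; lia.
Qed.

Lemma pell_le1 m : pell m <= 1.
Proof.
have [i [r [-> lt_r]]] := bd_cover m; rewrite pell_bd //.
by move: lt_r; rewrite /pell_sub; case: (_ == 0); case: r => [|[|[|r]]].
Qed.

Lemma pell_0or1 i : pell i = 0 \/ pell i = 1.
Proof. by have := pell_le1 i; case: (pell i) => [|[|]] //; [left|right]. Qed.

Lemma bd0 : bd 0 = 0. Proof. by []. Qed.

Lemma bd_succ i : bd i.+1 + 2 * pell i = bd i + 3.
Proof.
rewrite bdS /pell_sub; have := pell_le1 i.
by case: (pell i) => [|[|]] //= _; lia.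
Qed.

Lemma pell_bd0 i : pell (bd i) = 0.
Proof.
rewrite -[bd i]addn0 pell_bd; last by rewrite /pell_sub; case: (_ == 0).
by rewrite /pell_sub; case: (_ == 0).
Qed.

Lemma pell_bd1 i : pell (bd i + 1) = 0.
Proof.
have [p0|p1] := eqVneq (pell i) 0; first by rewrite pell_bd ?p0.
have -> : bd i + 1 = bd i.+1 by have := bd_succ i; have := pell_le1 i; lia.
exact: pell_bd0.
Qed.

(** A block 001 ends with 1, while a block 0 is followed by 00. *)
Lemma pell_bd2 i : pell (bd i + 2) = 1 - pell i.
Proof.
have [p0|p1] := eqVneq (pell i) 0; first by rewrite pell_bd ?p0.
have p1' : pell i = 1 by have := pell_le1 i; lia.
have -> : bd i + 2 = bd i.+1 + 1 by have := bd_succ i; lia.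
by rewrite pell_bd1 p1'.
Qed.

Lemma bd_decomp m : exists i r, [/\ m = bd i + r, r <= 2 & r + 2 * pell i < 3].
Proof.
have [i [r [-> lt_r]]] := bd_cover m; exists i, r; move: lt_r.
rewrite /pell_sub; have := pell_le1 i.
by case: (pell i) => [|[|]] //= _ lt_r; split=> //; lia.
Qed.

Lemma bd_of_00 j : pell j = 0 -> pell j.+1 = 0 -> exists i, j = bd i.
Proof.
have [i [[|[|[|r]]] [-> //= le_r lt_r]]] := bd_decomp j.
- by rewrite addn0; exists i.
- by move=> _; rewrite -addnS pell_bd2; lia.
- by rewrite pell_bd2; lia.
Qed.

Lemma bd_of_1 j : pell j = 1 -> exists2 i, j = bd i + 2 & bd i.+1 = bd i + 3.
Proof.
have [i [[|[|[|r]]] [-> //= le_r lt_r]]] := bd_decomp j.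
- by rewrite addn0 pell_bd0.
- by rewrite pell_bd1.
- by move=> _; exists i => //; have := bd_succ i; lia.
Qed.

Lemma pell_pred_1 j : pell j = 1 -> exists2 i, j = i.+2 & pell i = 0 /\ pell i.+1 = 0.
Proof.
case/bd_of_1=> i -> _; exists (bd i); first by rewrite addn2.
by rewrite -[(bd _).+1]addn1 pell_bd0 pell_bd1.
Qed.

Lemma pell_succ_1 j : pell j = 1 -> pell j.+1 = 0 /\ pell j.+2 = 0.
Proof.
case/bd_of_1=> i -> Ei; have -> : (bd i + 2).+1 = bd i.+1 by lia.
by rewrite -[(bd _).+1]addn1 pell_bd0 pell_bd1.
Qed.

Definition zeros m := count (fun i => pell i == 0) (iota 0 m).
Definition ones m := count (fun i => pell i == 1) (iota 0 m).

Lemma count_iotaD (t : pred nat) x n :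
  count t (iota 0 (x + n)) = count t (iota 0 x) + count t (iota x n).
Proof. by rewrite iotaD count_cat. Qed.

Lemma zerosS m : zeros m.+1 = zeros m + (1 - pell m).
Proof.
rewrite /zeros -[m.+1]addn1 count_iotaD /= addn0; have := pell_le1 m.
by case: (pell m) => [|[|]].
Qed.

Lemma onesS m : ones m.+1 = ones m + pell m.
Proof.
rewrite /ones -[m.+1]addn1 count_iotaD /= addn0; have := pell_le1 m.
by case: (pell m) => [|[|]].
Qed.

Lemma zeros_ones m : zeros m + ones m = m.
Proof.
by elim: m => // m IH; have := (zerosS m, onesS m, pell_le1 m) => -[[]]; lia.
Qed.

Lemma bdE i : bd i = 3 * zeros i + ones i.
Proof.
elim: i => // i IH; have := bd_succ i; have := pell_le1 i.
by rewrite zerosS onesS IH; lia.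
Qed.

Lemma ones_bd i : ones (bd i) = zeros i.
Proof.
elim: i => // i IH; have := bd_succ i; have := pell_le1 i.
case E: (pell i) => [|[|//]] _ Eb.
  have -> : bd i.+1 = (bd i).+3 by lia.
  rewrite !onesS zerosS E -[(bd i).+2]addn2 -[(bd i).+1]addn1.
  by rewrite pell_bd0 pell_bd1 pell_bd2 E; lia.
have -> : bd i.+1 = (bd i).+1 by lia.
by rewrite onesS zerosS E pell_bd0; lia.
Qed.

Lemma zeros_bd i : zeros (bd i) = 2 * zeros i + ones i.
Proof. by have := zeros_ones (bd i); rewrite ones_bd bdE; lia. Qed.

(** The 1 of a block 001 is its last letter, so an incomplete block adds only 0s. *)
Lemma bd_decomp_count m : exists i r, [/\ m = bd i + r, r <= 2,
  zeros m = 2 * zeros i + ones i + r & ones m = zeros i].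
Proof.
have [i [r [-> le_r lt_r]]] := bd_decomp m; exists i, r.
have Eo : ones (bd i + r) = zeros i.
  case: r le_r {lt_r} => [|[|[|//]]] _; rewrite ?addn0 ?addn1 ?addn2 ?onesS ?ones_bd //.
    by rewrite pell_bd0 addn0.
  by rewrite -[(bd i).+1]addn1 pell_bd0 pell_bd1 !addn0.
by split=> //; have := zeros_ones (bd i + r); rewrite Eo {2}bdE; lia.
Qed.

(* The blocks containing the four endpoints satisfy the same inequalities with
   the roles of the two intervals, and of the two letters, exchanged. *)
Lemma pell_balanced x x' y y' :
  zeros y' + zeros x + 2 <= zeros y + zeros x' ->
  ones x' + ones y + 2 <= ones x + ones y' -> False.
Proof.
move: {-1}(x + x' + y + y') (leqnn (x + x' + y + y')) => n.
elim/ltn_ind: n x x' y y' => n IH x x' y y'.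
have [i [r [Ex rx -> ->]]] := bd_decomp_count x.
have [i' [r' [Ex' rx' -> ->]]] := bd_decomp_count x'.
have [j [q [Ey ry -> ->]]] := bd_decomp_count y.
have [j' [q' [Ey' ry' -> ->]]] := bd_decomp_count y'.
move=> le_n H1 H2.
have := (zeros_ones i, zeros_ones i', zeros_ones j, zeros_ones j') => -[[[]]].
have := (bdE i, bdE i', bdE j, bdE j') => -[[[]]] *.
(* Twice the inequality [H2] absorbs the offsets, since [q + r'] is at most 4. It also forces 0s
   before [i] or [j'], so the sum of endpoints drops. *)
by apply: (IH (j + j' + i + i') _ j j' i i') => //; lia.
Qed.

(** * Occurrences and desubstitution *)

Definition agree x y n := forall m, m < n -> pell (x + m) = pell (y + m).

Lemma agreeP x y n : reflect (agree x y n) (factor_at pell x n == factor_at pell y n).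
Proof.
apply: (iffP eqP) => [E m lt_m|E].
  by have := congr1 (nth 0 ^~ m) E; rewrite !nth_mkseq.
by apply: (@eq_from_nth _ 0); rewrite !size_mkseq // => m lt_m; rewrite !nth_mkseq ?E.
Qed.

Lemma agree_le x y n m : m <= n -> agree x y n -> agree x y m.
Proof. by move=> le_m A j lt_j; apply: A; apply: leq_trans le_m. Qed.

Lemma agreeS x y n : agree x y n -> pell (x + n) = pell (y + n) -> agree x y n.+1.
Proof.
by move=> A E m; rewrite ltnS leq_eqVlt => /orP[/eqP->|/A].
Qed.

Lemma agree_shift x y n a k : agree x y n -> a + k <= n -> agree (x + a) (y + a) k.
Proof. by move=> A le_n m lt_m; rewrite -!addnA A //; lia. Qed.

Lemma bd_lt x y : x < y -> bd x < bd y.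
Proof.
elim: y => // y IH; rewrite ltnS leq_eqVlt => lexy.
have := bd_succ y; have := pell_le1 y.
by case/orP: lexy => [/eqP->|/IH]; lia.
Qed.

Lemma bd_le x y : x <= y -> bd x <= bd y.
Proof. by rewrite leq_eqVlt => /orP[/eqP->|/bd_lt/ltnW]. Qed.

Lemma bd_gt x : 0 < x -> x + 2 <= bd x.
Proof.
elim: x => // -[|x] IH _; first by rewrite bdS.
by have := IH isT; have := @bd_lt x.+1 x.+2 (ltnSn _); lia.
Qed.

Lemma bd_agree x y n : agree x y n -> bd (x + n) + bd y = bd (y + n) + bd x.
Proof.
elim: n => [|n IH] A; first by rewrite !addn0 addnC.
have := IH (agree_le (leqnSn n) A); have := A n (ltnSn n).
by rewrite !addnS; have := (bd_succ (x + n), bd_succ (y + n)) => -[]; lia.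
Qed.

(** The two extra letters come from the 00 that starts at every block boundary. *)
Lemma agree_bd x y n :
  agree x y n -> agree (bd x) (bd y) (bd (x + n) - bd x + 2).
Proof.
elim: n => [|n IH] A.
  rewrite addn0 subnn => -[|[|//]] _; rewrite ?addn0 ?pell_bd0 //.
  by rewrite !pell_bd1.
have A' := agree_le (leqnSn n) A; have {}IH := IH A'.
have := bd_agree A'; have := A n (ltnSn n).
have := bd_succ (x + n); have := bd_succ (y + n); have := pell_le1 (x + n).
have := bd_le (leq_addr n x); have := bd_le (leq_addr n y).
have := pell_bd2 (x + n); have := pell_bd2 (y + n).
set X := bd (x + n) in IH *; set Y := bd (y + n) => EY EX lY lX lp SY SX Ep EXY.
have {EX EY} AX : agree (bd x) (bd y) (X - bd x + 3).
  rewrite [_ + 3]addnS; apply: agreeS => //.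
  have -> : bd x + (X - bd x + 2) = X + 2 by lia.
  have -> : bd y + (X - bd x + 2) = Y + 2 by lia.
  by rewrite EX EY Ep.
rewrite [x + n.+1]addnS; case E: (pell (x + n)) lp => [|[|//]] _; last first.
  by apply: agree_le AX; lia.
have -> : bd (x + n).+1 - bd x + 2 = (X - bd x + 3).+2 by lia.
apply: agreeS; first apply: agreeS => //.
  have -> : bd x + (X - bd x + 3) = bd (x + n).+1 by lia.
  have -> : bd y + (X - bd x + 3) = bd (y + n).+1 by lia.
  by rewrite !pell_bd0.
have -> : bd x + (X - bd x + 3).+1 = bd (x + n).+1 + 1 by lia.
have -> : bd y + (X - bd x + 3).+1 = bd (y + n).+1 + 1 by lia.
by rewrite !pell_bd1.
Qed.

(** By [pell_bd2] the third letter from a boundary reveals the desubstituted letter; the two extra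
    letters never have to be read beyond the last block. *)
Lemma agree_of_bd x y n :
  agree (bd x) (bd y) (bd (x + n) - bd x + 2) -> agree x y n.
Proof.
elim: n => // n IH A.
have lt1 := @bd_lt (x + n) (x + n.+1) ltac:(lia).
have le1 := bd_le (leq_addr n x); have le2 := bd_le (leq_addr n y).
have {}IH : agree x y n by apply/IH/(agree_le _ A); lia.
apply: agreeS => //; have := A (bd (x + n) - bd x + 2) ltac:(lia).
have -> : bd x + (bd (x + n) - bd x + 2) = bd (x + n) + 2 by lia.
have -> : bd y + (bd (x + n) - bd x + 2) = bd (y + n) + 2.
  by have := bd_agree IH; lia.
by rewrite !pell_bd2; have := (pell_le1 (x + n), pell_le1 (y + n)) => -[]; lia.
Qed.

(* Block boundaries are the occurrences of 00, and the third letter after a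
   boundary determines the block, so occurrences can be desubstituted. *)
Lemma agree_desubst x m n : agree (bd x) m (bd (x + n) - bd x + 2) ->
  exists2 y, m = bd y & agree x y n.
Proof.
move=> A; have [||y Em] := @bd_of_00 m.
- by rewrite -[m]addn0 -A ?addn0 ?pell_bd0 //; lia.
- by rewrite -addn1 -A ?pell_bd1 //; lia.
by exists y => //; apply: agree_of_bd; rewrite -Em.
Qed.

(** * Returns with different lengths *)

(* [d0] and [d1] are the differences between the numbers of 0s and of 1s in a
   complete return from [j] to [j'] and in a return from [i] to [i']. *)
Definition returns a n d0 d1 := exists i i' j j',
  [/\ agree a i n, agree a i' n, agree a j n & agree a j' n] /\
  [/\ i < i', j < j', forall m, j < m < j' -> ~ agree a m n,
      zeros j' + zeros i = zeros j + zeros i' + d0 &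
      ones j' + ones i = ones j + ones i' + d1].

(** The last two cases are the exceptions: the difference (0,1) for the factor 0 becomes (1,0) for
    00100, then (2,1), which falls in the first case. *)
Definition return_gap a n := exists d0 d1, returns a n d0 d1 /\
  [\/ 2 <= d0 + d1, [/\ d0 = 1, d1 = 0 & n <= 5] |
      [/\ d0 = 0, d1 = 1, n = 1 & pell a = 0]].

(** When the preceding letter is forced, both factors have the same occurrences up to a shift by 1,
    hence the same returns. *)
Lemma return_gap_left a n : 0 < n ->
  (forall m, agree a.+1 m n -> exists2 m', m = m'.+1 & pell m' = pell a) ->
  return_gap a n.+1 -> return_gap a.+1 n.
Proof.
move=> n_gt0 ext [d0 [d1 [ret cases]]]; exists d0, d1; split; last first.
  by case: cases => [?|[? ? ?]|[? ? ?]]; [apply: Or31|apply: Or32; split|]; lia.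
have shift m : agree a m n.+1 -> agree a.+1 m.+1 n.
  by move/(@agree_shift _ _ _ 1 n); rewrite !addn1; apply.
have head m : agree a m n.+1 -> pell m = pell a.
  by move/(_ 0 isT); rewrite !addn0.
have [i [i' [j [j' [[Ai Ai' Aj Aj'] [lti ltj gap Ez Eo]]]]]] := ret.
exists i.+1, i'.+1, j.+1, j'.+1; split; first by split; apply: shift.
rewrite !zerosS !onesS !head //; split; rewrite ?ltnS //; try lia.
move=> m bm Am; have [m' Em Ep] := ext m Am; apply: (gap m'); first lia.
move=> [|r] lt_r; rewrite ?addn0 // -!addSnnS -Em; exact: Am.
Qed.

Lemma return_gap_right a n : 0 < n ->
  (forall m, agree a m n -> pell (m + n) = pell (a + n)) ->
  return_gap a n.+1 -> return_gap a n.
Proof.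
move=> n_gt0 ext [d0 [d1 [ret cases]]]; exists d0, d1; split; last first.
  by case: cases => [?|[? ? ?]|[? ? ?]]; [apply: Or31|apply: Or32; split|]; lia.
have [i [i' [j [j' [[Ai Ai' Aj Aj'] [lti ltj gap Ez Eo]]]]]] := ret.
exists i, i', j, j'; split; first by split; apply: agree_le (leqnSn n) _.
split=> // m bm Am; apply: (gap m bm); apply: agreeS => //.
by rewrite ext.
Qed.

Lemma return_gap_bd x n : 0 < n -> return_gap x n ->
  return_gap (bd x) (bd (x + n) - bd x + 2).
Proof.
move=> n_gt0 [d0 [d1 [ret cases]]]; exists (2 * d0 + d1), d0; split; last first.
  case: cases => [?|[? ? ?]|[? ? En px]]; [by apply: Or31; lia|by apply: Or31; lia|].
  (* The image of the factor 0, followed by 00, is 00100, of length 5. *)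
  apply: Or32; split; [lia|lia|].
  by rewrite En addn1; have := bd_succ x; lia.
have [i [i' [j [j' [[Ai Ai' Aj Aj'] [lti ltj gap Ez Eo]]]]]] := ret.
exists (bd i), (bd i'), (bd j), (bd j'); split; first by split; apply: agree_bd.
split; rewrite ?bd_lt ?zeros_bd ?ones_bd //; try lia.
move=> m bm /agree_desubst[y Em]; apply: gap; move: bm; rewrite Em.
case: (leqP y j) => [/bd_le|lt_y]; first lia.
by case: (leqP j' y) => [/bd_le|lt_y']; lia.
Qed.

Lemma return_gap_0 a : pell a = 0 -> return_gap a 1.
Proof.
move=> pa; have A m : pell m = 0 -> agree a m 1.
  by move=> pm [|//] _; rewrite !addn0 pa.
exists 0, 1; split; last exact: Or33.
(* In the prefix 0010 the returns to 0 at positions 0 and 1 are 0 and 01. *)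
exists 0, 1, 1, 3; split; first by split; apply: A.
split=> // -[|[|[|m]]] // _ /(_ 0 isT).
by rewrite addn0 pa.
Qed.

Lemma return_gap_00 a : pell a = 0 -> pell a.+1 = 0 -> return_gap a 2.
Proof.
move=> pa pa1; have A m : pell m = 0 -> pell m.+1 = 0 -> agree a m 2.
  by move=> pm pm1 [|[|//]] _; rewrite ?addn0 ?pa ?addn1 ?pa1.
exists 1, 1; split; last exact: Or31.
(* In the prefix 001001000 the returns to 00 at positions 6 and 0 are 0 and 001. *)
exists 6, 7, 0, 3; split; first by split; apply: A; vm_compute.
split=> //.
move=> -[|[|[|m]]] // _.
  by move=> /(_ 1 isT); rewrite addn1 pa1.
by move=> /(_ 0 isT); rewrite addn0 pa.
Qed.

(** A factor other than 00 that starts and ends with 00 runs between two block boundaries, so it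
    desubstitutes. Its end position then drops by more than 2, which leaves room for two letters
    appended beforehand. *)
Lemma return_gap_closed a n : 1 < n ->
  (forall x k, 0 < k -> x + k + 2 < a + n -> return_gap x k) ->
  pell a = 0 -> pell a.+1 = 0 -> pell (a + n - 2) = 0 -> pell (a + n - 1) = 0 ->
  return_gap a n.
Proof.
move=> n_gt1 IH pa0 pa1 pb0 pb1.
have [->|neq_n2] := eqVneq n 2; first exact: return_gap_00.
have [x Ea] := bd_of_00 pa0 pa1.
have [|y Eb] := bd_of_00 pb0; first by rewrite -pb1; congr pell; lia.
have ltxy : x < y by rewrite ltnNge; apply/negP => /bd_le; lia.
have := @return_gap_bd x (y - x); rewrite (subnKC (ltnW ltxy)) -Ea -Eb.
have -> : a + n - 2 - a + 2 = n by lia.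
apply; first lia.
by apply: IH; have := @bd_gt y; lia.
Qed.

Lemma return_gap_01 c n : 1 < n -> pell c.+2 = 1 ->
  return_gap c n.+1 -> return_gap c.+1 n.
Proof.
move=> n_gt1 p1; apply: return_gap_left => [|m A]; first lia.
have [i Em [p0 _]] : exists2 i, m.+1 = i.+2 & pell i = 0 /\ pell i.+1 = 0.
  by apply: pell_pred_1; rewrite -addn1 -A // addn1.
have [c' [->] [-> _]] := pell_pred_1 p1.
by exists i; case: Em.
Qed.

Lemma return_gap_1 c n : 0 < n -> pell c.+2 = 1 ->
  return_gap c.+1 n.+1 -> return_gap c.+2 n.
Proof.
move=> n_gt0 p1; apply: return_gap_left => // m A.
have [i -> [_ p0]] : exists2 i, m = i.+2 & pell i = 0 /\ pell i.+1 = 0.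
  by apply: pell_pred_1; rewrite -[m]addn0 -A // addn0.
have [c' [->] [_ ->]] := pell_pred_1 p1.
by exists i.+1.
Qed.

(** Every 1 is followed by 00, so a 1 among the last two letters forces the next letter. *)
Lemma return_gap_right1 c n d : d <= 1 -> d < n -> pell (c + n - d.+1) = 1 ->
  return_gap c n.+1 -> return_gap c n.
Proof.
move=> d_le1 lt_dn p1; apply: return_gap_right => [|m A]; first lia.
have q1 : pell (m + n - d.+1) = 1.
  rewrite -addnBA // -A; [by rewrite addnBA | lia].
have := (pell_succ_1 p1, pell_succ_1 q1) => -[[a1 a2] [b1 b2]].
case: d d_le1 lt_dn {p1 q1} a1 a2 b1 b2 => [|[|//]] _ lt_dn a1 a2 b1 b2.
  have -> : m + n = (m + n - 1).+1 by lia.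
  by have -> : c + n = (c + n - 1).+1; [lia | rewrite a1 b1].
have -> : m + n = (m + n - 2).+2 by lia.
by have -> : c + n = (c + n - 2).+2; [lia | rewrite a2 b2].
Qed.

Lemma return_gap_factor a n : 0 < n -> return_gap a n.
Proof.
(* The induction is on the end position [a + n], which extensions to the left do not change. *)
move: {-1}(a + n) (leqnn (a + n)) => b; elim/ltn_ind: b a n => b IH a n le_b n_gt0.
have {}IH x k : 0 < k -> x + k < a + n -> return_gap x k.
  by move=> k_gt0 lt_xk; apply: (IH (x + k)) => //; lia.
have closed c k : 1 < k -> c + k <= a + n + 2 -> pell c = 0 -> pell c.+1 = 0 ->
    pell (c + k - 2) = 0 -> pell (c + k - 1) = 0 -> return_gap c k.
  by move=> *; apply: return_gap_closed => // *; apply: IH => //; lia.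
(* A factor starting with 01 or 1 is completed on the left to one starting with 00. *)
have right_closed c k : 1 < k -> c + k <= a + n + 2 ->
    pell (c + k - 2) = 0 -> pell (c + k - 1) = 0 -> return_gap c k.
  move=> k_gt1 le_ck p2 p1.
  have [pc0|pc1] := pell_0or1 c.
    have [pc1|pc1] := pell_0or1 c.+1; first exact: closed.
    have [c' [Ec] [? ?]] := pell_pred_1 pc1; rewrite Ec in le_ck p2 p1 pc1 *.
    apply: return_gap_01 => //; apply: closed; rewrite -?addSnnS //; lia.
  have [c' Ec [? ?]] := pell_pred_1 pc1; rewrite Ec in le_ck p2 p1 pc1 *.
  apply: return_gap_1 => //; first lia; apply: return_gap_01 => //; first lia.
  by apply: closed; rewrite -?addSnnS //; lia.
(* On the right, two letters are appended after a final 1, one after a final 10, and none after a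
   final 00. *)
have [pb0|pb1] := pell_0or1 (a + n - 1); last first.
  have [] := pell_succ_1 pb1.
  have -> : (a + n - 1).+1 = a + n by lia.
  move=> q0 q1; apply: (@return_gap_right1 _ _ 0) => //.
  apply: (@return_gap_right1 _ _ 1) => //.
    by rewrite -pb1; congr pell; lia.
  apply: right_closed; rewrite ?addnS ?subSS ?subn0 //; lia.
have [n_le1|n_gt1] := leqP n 1.
  have -> : n = 1 by lia.
  by apply: return_gap_0; rewrite -pb0; congr pell; lia.
have [pb1|pb1] := pell_0or1 (a + n - 2); first by apply: right_closed => //; lia.
have [] := pell_succ_1 pb1.
have -> : (a + n - 2).+2 = a + n by lia.
move=> q0 q1; apply: (@return_gap_right1 _ _ 1) => //.
by apply: right_closed; rewrite ?addnS ?subSS ?subn0 //; lia.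
Qed.

(** * Counting occurrences *)

Lemma is_factor_at x n : is_factor pell (factor_at pell x n).
Proof. by exists x; rewrite size_mkseq. Qed.

Lemma take_drop_factor x n N i : i + n <= N ->
  take n (drop i (factor_at pell x N)) = factor_at pell (x + i) n.
Proof.
move=> le_N; apply: (@eq_from_nth _ 0).
  by rewrite size_takel ?size_drop /factor_at !size_mkseq //; lia.
move=> j; rewrite size_takel ?size_drop ?size_mkseq; last lia.
move=> lt_j; rewrite nth_take // nth_drop !nth_mkseq ?addnA //; lia.
Qed.

Definition occurs a n : pred nat := fun m => factor_at pell a n == factor_at pell m n.

Lemma occ_factor a n x N : n <= N ->
  occ (factor_at pell a n) (factor_at pell x N) = count (occurs a n) (iota x (N - n).+1).
Proof.
move=> le_n; rewrite /occ !size_mkseq -[in RHS](addn0 x) iotaDl count_map.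
apply: eq_in_count => i; rewrite mem_iota => /andP[_ lt_i] /=.
by rewrite take_drop_factor 1?eq_sym //; lia.
Qed.

Lemma occ_long a n x N : N < n -> occ (factor_at pell a n) (factor_at pell x N) = 0.
Proof.
move=> lt_N; rewrite /occ !size_mkseq; have -> : N - n = 0 by lia.
rewrite /= drop0 take_oversize ?size_mkseq 1?ltnW //.
case: eqP => // /(congr1 size); rewrite !size_mkseq; lia.
Qed.

(** Prefixes suffice, as each factor lies in one. From the letter 0 at position 3, [bd] turns a
    later occurrence of a prefix into a still later one of a longer prefix. *)
Lemma pell_recurrent s x n : exists2 y, s <= y & agree x y n.
Proof.
suff [z lt_z A] : exists2 z, s + (x + n) < z & agree 0 z (s + (x + n)).+1.
  exists (z + x); first lia.
  by rewrite -{1}[x]add0n; apply: agree_shift A _; lia.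
elim: (s + _) => [|m [z lt_z A]]; first by exists 3 => // -[|//].
exists (bd z); first by have := @bd_gt z; lia.
have := agree_bd A; rewrite bd0 add0n subn0 => /agree_le; apply.
by have := @bd_gt m.+1 isT; lia.
Qed.

(** Recurrence moves both windows beyond [b], so a factor found [s] letters inside a longer pattern
    can be counted without boundary effects. *)
Lemma not_unbalanced_of_count s k C b : 0 < k ->
  (forall x y M, b <= x -> b <= y ->
     count (occurs s k) (iota x M) <= count (occurs s k) (iota y M) + C) ->
  ~ totally_unbalanced pell k C.
Proof.
move=> k_gt0 bal /(_ (factor_at pell s k) (size_mkseq _ _) (is_factor_at _ _)).
case=> u [v [[x0 ->] [y0 ->] ]]; rewrite !size_mkseq => <-.
set N := size u; have [lt_N|le_k] := ltnP N k; first by rewrite !occ_long //; case.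
have [x le_x /agreeP/eqP->] := pell_recurrent b x0 N.
have [y le_y /agreeP/eqP->] := pell_recurrent b y0 N.
rewrite !occ_factor //.
have := bal x y (N - k).+1 le_x le_y; have := bal y x (N - k).+1 le_y le_x.
by move=> ? ? []; lia.
Qed.

(** * Lengths below 6 *)

Lemma count_zeros x n : zeros (x + n) = zeros x + count (fun i => pell i == 0) (iota x n).
Proof. exact: count_iotaD. Qed.

Lemma zeros_balanced x y n : zeros (x + n) + zeros y <= zeros x + zeros (y + n) + 1.
Proof.
rewrite leqNgt; apply/negP => lt.
have := (zeros_ones x, zeros_ones y, zeros_ones (x + n), zeros_ones (y + n)) => -[[[]]] *.
by apply: (@pell_balanced x (x + n) y (y + n)) => //; lia.
Qed.

Lemma count_zeros_balanced x y n : count (fun i => pell i == 0) (iota x n) <=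
  count (fun i => pell i == 0) (iota y n) + 1.
Proof. by have := zeros_balanced x y n; rewrite !count_zeros; lia. Qed.

Lemma count_ones_balanced x y n : count (fun i => pell i == 1) (iota x n) <=
  count (fun i => pell i == 1) (iota y n) + 1.
Proof.
have E z : count (fun i => pell i == 1) (iota z n) = n - count (fun i => pell i == 0) (iota z n).
  rewrite -[n in n - _](size_iota z) -(count_predC (fun i => pell i == 0)) addKn.
  by apply: eq_count => i /=; case: (pell_0or1 i) => ->.
by rewrite !E; have := count_zeros_balanced y x n; lia.
Qed.

(** The factors 0, 01, 001, 0010 and 00100 each occur as often as a single letter, and letters are
    balanced. *)
Lemma not_unbalanced1 k : 0 < k -> k < 6 -> ~ totally_unbalanced pell k 1.
Proof.
move=> k_gt0 k_lt6; have [->|k_neq1] := eqVneq k 1.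
  apply: (@not_unbalanced_of_count 0 1 1 0) => // x y M _ _.
  have E z : count (occurs 0 1) (iota z M) = count (fun i => pell i == 0) (iota z M).
    apply: eq_count => i; apply/agreeP/eqP => [/(_ 0 isT)|p0 [|//] _].
      by rewrite !addn0 => <-.
    by rewrite (addn0 i) p0.
  by rewrite !E count_zeros_balanced.
(* The factor of length k at [s] contains exactly one 1, and every 1 lies in an
   occurrence of 00100, so its occurrences are those of 1 up to a shift. *)
pose s : nat := k == 2.
apply: (@not_unbalanced_of_count s k 1 0) => // x y M _ _.
have E m : occurs s k m = (pell (m + 2 - s) == 1).
  rewrite /s; have [->|k_neq2] := eqVneq k 2.
    rewrite -addnBA //; apply/agreeP/eqP => [A|p1]; first exact: esym (A 1 isT).
    have [i Em [p0 p0']] := pell_pred_1 p1; have Ei : m = i.+1 by lia.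
    by rewrite Ei => -[|[|//]] _; [rewrite !addn0 p0' | rewrite (addn1 i.+1) -Em p1].
  rewrite subn0; apply/agreeP/eqP => [A|p1]; first exact: esym (A 2 ltac:(lia)).
  have [i Em [p0 p0']] := pell_pred_1 p1; have [q0 q1] := pell_succ_1 p1.
  have Ei : i = m by lia.
  rewrite -Ei; rewrite Em in p1 q0 q1; move=> j lt_j; have {lt_j} : j < 5 by lia.
  by case: j => [|[|[|[|[|//]]]]] _; rewrite [in RHS]addnC //= ?add0n.
have {}E z : count (occurs s k) (iota z M) =
             count (fun i => pell i == 1) (iota (2 - s + z) M).
  rewrite iotaDl count_map; apply: eq_count => i /=; rewrite E; congr (pell _ == _).
  by rewrite /s; case: eqP => _; lia.
by rewrite !E count_ones_balanced.
Qed.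

(** * The bound 2 for every length *)

(** [A] and [B] are the lengths of the [n]-th images of 0 and 1. *)
Lemma iter_bd n : exists A B,
  [/\ 0 < B, B <= A & forall i, iter n bd i = A * zeros i + B * ones i].
Proof.
elim: n => [|n [A [B [B_gt0 leBA E]]]].
  by exists 1, 1; split=> // i; rewrite !mul1n zeros_ones.
exists (2 * A + B), A; split; [lia|lia|] => i.
by rewrite iterSr E zeros_bd ones_bd; lia.
Qed.

Lemma iter_bd_lt n x y : x < y -> iter n bd x < iter n bd y.
Proof. by move=> lt; elim: n => //= n; apply: bd_lt. Qed.

(** Here [x] is the index of the first image starting at or after [X], which turns counts of
    positions into counts of 0s. *)
Lemma count_markers n (t : pred nat) :
  (forall m, t m <-> exists2 i, m = iter n bd i & pell i = 0) ->
  forall X, exists x, [/\ X <= iter n bd x, forall i, i < x -> iter n bd i < X &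
                          count t (iota 0 X) = zeros x].
Proof.
move=> Et; elim=> [|X [x [le_X lt_X E]]]; first by exists 0.
rewrite -addn1 count_iotaD E /= addn0.
have [Ex|neX] := eqVneq (iter n bd x) X.
  exists x.+1; split.
  - by rewrite addn1 -Ex iter_bd_lt.
  - by move=> i; rewrite ltnS leq_eqVlt => /orP[/eqP->|/lt_X]; lia.
  rewrite zerosS; have [p0|p1] := pell_0or1 x.
    by have -> : t X; [apply/Et; exists x; rewrite ?Ex | rewrite p0].
  case tX: (t X); last by rewrite p1.
  have [i Ei pi0] := (Et X).1 tX; rewrite -Ex in Ei.
  have : i = x by case: (ltngtP i x) => // /(iter_bd_lt n); lia.
  by move=> Eix; rewrite Eix p1 in pi0.
exists x; split; [lia|by move=> i /lt_X; lia|].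
case tX: (t X); last by rewrite addn0.
have [i Ei pi0] := (Et X).1 tX.
have [/lt_X|le_xi] := ltnP i x; first lia.
move: le_xi; rewrite leq_eqVlt => /orP[/eqP Exi|/(iter_bd_lt n) lt_xi].
  by rewrite Exi Ei eqxx in neX.
lia.
Qed.

Lemma weighted_le A B z o z' o' k : B <= A -> z + k <= z' -> o <= o' + k ->
  A * z + B * o <= A * z' + B * o'.
Proof.
move=> leBA lez leo; apply: (@leq_trans (A * z + B * (o' + k))).
  by rewrite leq_add2l leq_mul2l leo orbT.
apply: (@leq_trans (A * (z + k) + B * o')); last by rewrite leq_add2r leq_mul2l lez orbT.
by rewrite !mulnDr; have := leq_mul leBA (leqnn k); lia.
Qed.

Lemma count_markers_balanced n (t : pred nat) :
  (forall m, t m <-> exists2 i, m = iter n bd i & pell i = 0) ->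
  forall X Y M, count t (iota X M) <= count t (iota Y M) + 2.
Proof.
move=> Et X Y M; have cnt := count_markers Et.
have [x [le_x lt_x Ex]] := cnt X; have [x' [le_x' lt_x' Ex']] := cnt (X + M).
have [y [le_y lt_y Ey]] := cnt Y; have [y' [le_y' lt_y' Ey']] := cnt (Y + M).
rewrite count_iotaD in Ex'; rewrite count_iotaD in Ey'.
rewrite leqNgt; apply/negP => gt2.
have [A [B [B_gt0 leBA E]]] := iter_bd n.
case: x' => [|x'] in Ex' le_x' lt_x' *; first by have : zeros 0 = 0 by []; lia.
have {}lt_x' := lt_x' x' (ltnSn _); rewrite !E in le_x lt_x' le_y'.
have Zx' := zerosS x'.
(* The images of [x'] and [u] start before [X + M] and not after [Y], those of [x] and [y'] not
   before [X] and [Y + M]. As a 0 has the longer image, [k] extra 0s must be outweighed by more than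
   [k] 1s. *)
have key u k : A * zeros u + B * ones u <= Y -> zeros y' + zeros x + k <= zeros u + zeros x' ->
    ones x' + ones u + k < ones x + ones y'.
  move=> le_u lez; rewrite ltnNge; apply/negP => leo.
  have := @weighted_le A B (zeros y' + zeros x) (ones y' + ones x)
    (zeros u + zeros x') (ones u + ones x') k leBA lez ltac:(lia).
  rewrite !mulnDr; lia.
have [] := @pell_balanced x x' y y'; first lia.
case: y => [|y] in Ey le_y lt_y key *.
  by apply: ltnW; apply: key; rewrite ?muln0 //; lia.
have {}lt_y := lt_y y (ltnSn _); rewrite E in lt_y.
(* Stepping back from [y.+1] to [y] loses one 0 or one 1; either way the gap of 2 in 1s survives. *)
rewrite zerosS in Ey; rewrite onesS; have [py|py] := pell_0or1 y.
  by have := key y 1 (ltnW lt_y) ltac:(lia); lia.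
by have := key y 2 (ltnW lt_y) ltac:(lia); lia.
Qed.

(* The lengths of the prefixes obtained from the prefix 0 by iterating
   [w |-> pell_subw w ++ [:: 0; 0]]. *)
Definition marker_len n := iter n (fun l => bd l + 2) 1.

Lemma marker_prefix n m :
  agree 0 m (marker_len n) <-> exists2 i, m = iter n bd i & pell i = 0.
Proof.
elim: n m => [|n IH] m /=.
  split=> [/(_ 0 isT)|[i -> pi] [|//] _]; rewrite !addn0 //.
  by move=> E; exists m.
have E : bd (marker_len n) + 2 = bd (0 + marker_len n) - bd 0 + 2 by rewrite bd0 subn0.
rewrite {}E; split=> [A|[i -> pi]].
  have [|y Em Ay] := @agree_desubst 0 m (marker_len n); first exact: A.
  by have [i Ei pi] := (IH y).1 Ay; exists i; rewrite // Em Ei.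
by apply: (@agree_bd 0); apply/IH; exists i.
Qed.

(* The prefix of length [marker_len n], followed by the letter that does not
   follow it at position 0, extends in a unique way to the next such prefix. *)
Lemma marker_short n : exists a, [/\ a + (marker_len n).+1 <= marker_len n.+1,
  agree 0 a (marker_len n) &
  forall m, agree a m (marker_len n).+1 -> a <= m /\ agree 0 (m - a) (marker_len n.+1)].
Proof.
elim: n => [|n [a [le_a A0 Aext]]].
  exists 1; split=> //; first by case.
  move=> m A; have [i Em] : exists2 i, m.+1 = bd i + 2 & bd i.+1 = bd i + 3.
    by apply: bd_of_1; rewrite -addn1 -A.
  move=> Ei; split; first lia.
  have -> : m - 1 = bd i by lia.
  have p0 : pell i = 0 by have := bd_succ i; lia.
  by apply: (@agree_bd 0 i 1) => -[|//]; rewrite !addn0 p0.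
set l := marker_len n in le_a A0 Aext; set l' := marker_len n.+1 in le_a Aext *.
have El' : l' = bd l + 2 by [].
have El'' : marker_len n.+2 = bd l' + 2 by [].
have Ea : bd (a + l) = bd a + bd l by have := bd_agree A0; rewrite add0n bd0; lia.
exists (bd a); split.
- by have := @bd_lt (a + l) l' ltac:(lia); lia.
- by have := agree_bd A0; rewrite bd0 add0n subn0.
move=> m A; have [|y Em Ay] := @agree_desubst a m l.
  by apply: agree_le A; lia.
have Ey := bd_agree Ay.
have last_letter : pell (a + l) = pell (y + l).
  have := A l' (ltnSn _).
  have -> : bd a + l' = bd (a + l) + 2 by lia.
  have -> : m + l' = bd (y + l) + 2 by lia.
  by rewrite !pell_bd2; have := (pell_le1 (a + l), pell_le1 (y + l)) => -[]; lia.
have [le_ay Aya] := Aext y (agreeS Ay last_letter).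
have Eya : bd y = bd a + bd (y - a).
  have := bd_agree (agree_le _ Aya : agree 0 (y - a) a).
  by rewrite add0n bd0 subnK //; lia.
split; first lia.
have -> : m - bd a = bd (y - a) by lia.
by have := agree_bd Aya; rewrite bd0 add0n subn0.
Qed.

(** Between two consecutive marker lengths, a factor that covers the piece given by [marker_short]
    has the occurrences of the longer marker, shifted. *)
Lemma marker_factor n k : 0 < k -> k <= marker_len n -> exists s n',
  forall m, agree s m k <-> s <= m /\ agree 0 (m - s) (marker_len n').
Proof.
move=> k_gt0; elim: n => [|n IH] le_k.
  exists 0, 0.
  have -> : k = 1 by rewrite /= in le_k; lia.
  by move=> m; rewrite subn0; split=> [|[]].
have [/IH//|gt_k] := leqP k (marker_len n).
have [a [le_a A0 Aext]] := marker_short n.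
(* The minimum makes the factor start early enough to cover the piece at [a] and stay inside the
   longer prefix. *)
pose s := minn a (marker_len n.+1 - k); exists s, n.+1.
move=> m; split=> [A|[le_m A]]; last first.
  by have := agree_shift A (_ : s + k <= _); rewrite add0n subnK //; apply; lia.
have := @agree_shift _ _ _ (a - s) (marker_len n).+1 A ltac:(lia).
have -> : s + (a - s) = a by lia.
case/Aext => le_am A'; split; first lia.
by have <- : m + (a - s) - a = m - s by lia.
Qed.

Lemma not_unbalanced2 k : 0 < k -> ~ totally_unbalanced pell k 2.
Proof.
move=> k_gt0; have le_k n : n < marker_len n.
  by elim: n => //= n; have := @bd_gt (marker_len n); lia.
have [s [n Es]] := marker_factor k_gt0 (ltnW (le_k k)).
apply: (@not_unbalanced_of_count s k 2 s) => // x y M le_x le_y.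
have E z : s <= z ->
    count (occurs s k) (iota z M) = count (occurs 0 (marker_len n)) (iota (z - s) M).
  move=> le_z; rewrite -{1}(subnKC le_z) iotaDl count_map; apply: eq_count => m /=.
  apply/agreeP/agreeP => [/Es[_]|A]; first by rewrite addKn.
  by apply/Es; rewrite addKn leq_addr.
rewrite !E //; apply: (@count_markers_balanced n) => m.
by rewrite -marker_prefix; split=> /agreeP.
Qed.

(** * Lengths at least 6 *)

Lemma unbalanced1 k : 5 < k -> totally_unbalanced pell k 1.
Proof.
move=> k_gt5 w size_w [a]; rewrite size_w => ->.
have [d0 [d1 [[i [i' [j [j' [[Ai Ai' Aj Aj'] [lti ltj gap Ez Eo]]]]]] cases]]] :=
  @return_gap_factor a k ltac:(lia).
have d_ge2 : 2 <= d0 + d1 by case: cases => [|[]|[]]; lia.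
have := (zeros_ones i, zeros_ones i', zeros_ones j, zeros_ones j') => -[[[]]] *.
(* A window of this length at [i] contains both occurrences; at [j.+1] it contains none, because
   [j' - j] exceeds [i' - i] by at least 2. *)
pose N := k + (i' - i).
exists (factor_at pell i N), (factor_at pell j.+1 N).
split; rewrite ?size_mkseq //; try exact: is_factor_at.
left; rewrite !occ_factor ?leq_addr //; have -> : (N - k).+1 = (i' - i).+1 by lia.
have -> : count (occurs a k) (iota j.+1 (i' - i).+1) = 0.
  apply/eqP; rewrite -leqn0 leqNgt -has_count; apply/hasPn => m.
  rewrite mem_iota => bm; apply/negP => /agreeP; apply: gap; lia.
have -> : (i' - i).+1 = 1 + ((i' - i).-1 + 1) by lia.
rewrite !iotaD !count_cat /=.
have -> : i + 1 + (i' - i).-1 = i' by lia.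
have /agreeP Oi := Ai; have /agreeP Oi' := Ai'.
by rewrite /occurs Oi Oi'; lia.
Qed.

Theorem theorem18 :
  (forall k : nat, 1 <= k -> (totally_unbalanced pell k 1 <-> 6 <= k)) /\
  (forall k : nat, 1 <= k -> ~ totally_unbalanced pell k 2).
Proof.
split=> k k_gt0; last exact: not_unbalanced2.
split; last exact: unbalanced1.
by move=> unb; rewrite leqNgt; apply/negP => lt_k6; apply: not_unbalanced1 unb.
Qed.
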